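(* Let $G=(V,E)$ be a finite graph, let $\varepsilon>0$, and let $\mathcal{S}=\{S_i\}_{i\in V}$ be a scale on $G$ with dual scale $\overline{\mathcal{S}}=\{\overline{S}_i\}_{i\in V}$, $\overline{S}_i=\{j\in V: i\in S_j\}$. The following are equivalent: 1. there exists a collection $\{\xi_i\}_{i\in V}$ of probability measures on $G$ with $\varepsilon$ variation at scale $\mathcal{S}$; 2. there exists a partition of unity $\{\phi_i\}_{i\in V}$ on $G$ with $\varepsilon$ variation at scale $\overline{\mathcal{S}}$; 3. there exists a flat partition of unity $\{\psi_\alpha\}$ on $G$ with $\varepsilon$ variation subordinated to $\overline{\mathcal{S}}$.
   Context: A graph $G=(V,E)$ is oriented, with $E\subset V\times V$ and no self-loops. A scale on $G$ is a family of subsets of $V$ indexed by $V$. For a nonnegative function $f$ on $V$, $\operatorname{supp}f=\{j\in V:f(j)>0\}$. Probability measures with $\varepsilon$ variation at scale $\mathcal{S}=\{S_i\}$: functions $\xi_i\colon V\to\mathbb{R}$, $i\in V$, with $\xi_i\ge 0$, $\|\xi_i\|_1=1$, $\operatorname{supp}\xi_i\subset S_i$ for each $i\in V$, and $\|\xi_i-\xi_j\|_1\le\varepsilon$ for each $ij\in E$. Partition of unity with $\varepsilon$ variation at a scale $\mathcal{U}=\{U_i\}_{i\in V}$: functions $\phi_i\colon V\to\mathbb{R}$, $i\in V$, with $\phi_i\ge 0$, $\sum_{i\in V}\phi_i(j)=1$ for each $j\in V$, $\sum_{i\in V}|\phi_i(k)-\phi_i(j)|\le\varepsilon$ for each $kj\in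 E$, and $\operatorname{supp}\phi_i\subset U_i$ for each $i\in V$. Flat partition of unity with $\varepsilon$ variation subordinated to $\mathcal{U}$: a finite family $\{\psi_\alpha\}$ of functions $\psi_\alpha\colon V\to\mathbb{R}$ with $\psi_\alpha\ge 0$; each $\psi_\alpha$ constant on its support; $\sum_\alpha\psi_\alpha(i)=1$ for each $i\in V$; $\sum_\alpha|\psi_\alpha(k)-\psi_\alpha(j)|\le\varepsilon$ for each $kj\in E$; and for each $\alpha$ there is $U\in\mathcal{U}$ with $\operatorname{supp}\psi_\alpha\subset U$. *)

(* Defs.v *)
From HB Require Import structures.
From mathcomp Require Import all_boot all_order all_algebra.
From mathcomp Require Import reals.

Set Implicit Arguments.
Unset Strict Implicit.
Unset Printing Implicit Defensive.

Import Order.TTheory GRing.Theory Num.Theory.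
Local Open Scope ring_scope.

(* A finite graph is a vertex type V : finType with its edge relation E : rel V:
   E i j means that ij is an (oriented) edge. *)

Definition scale (V : finType) := V -> {set V}.

Definition dual_scale (V : finType) (S : scale V) : scale V :=
  fun i => [set j | i \in S j].

(* As in the source, the support is only meant for nonnegative functions. *)
Definition supp (R : realType) (V : finType) (f : V -> R) : {set V} :=
  [set j | 0 < f j].

Definition l1norm (R : realType) (V : finType) (f : V -> R) : R :=
  \sum_(j : V) `|f j|.

Definition probability_measures (R : realType) (V : finType) (E : rel V)
    (eps : R) (S : scale V) (xi : V -> V -> R) : Prop :=
  [/\ forall i j, 0 <= xi i j,
      forall i, l1norm (xi i) = 1,
      forall i, supp (xi i) \subset S i &
      forall i j, E i j -> l1norm (xi i \- xi j) <= eps].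

Definition partition_of_unity (R : realType) (V : finType) (E : rel V)
    (eps : R) (U : scale V) (phi : V -> V -> R) : Prop :=
  [/\ forall i j, 0 <= phi i j,
      forall j, \sum_(i : V) phi i j = 1,
      forall k j, E k j -> \sum_(i : V) `|phi i k - phi i j| <= eps &
      forall i, supp (phi i) \subset U i].

Definition flat_partition_of_unity (R : realType) (V : finType) (E : rel V)
    (eps : R) (U : scale V) (A : finType) (psi : A -> V -> R) : Prop :=
  [/\ forall a j, 0 <= psi a j,
      forall a, {in supp (psi a) &, forall j k, psi a j = psi a k},
      forall i, \sum_(a : A) psi a i = 1,
      forall k j, E k j -> \sum_(a : A) `|psi a k - psi a j| <= eps &
      forall a, exists i : V, supp (psi a) \subset U i].

(* Main.v *)
Require Import Defs.
From HB Require Import structures.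
From mathcomp Require Import all_boot all_order all_algebra.
From mathcomp Require Import reals.
From mathcomp Require Import lra.

Set Implicit Arguments.
Unset Strict Implicit.
Unset Printing Implicit Defensive.

Import Order.TTheory GRing.Theory Num.Theory.
Local Open Scope ring_scope.

(** Conditions 1 and 2 are transposes of each other: with [phi i j = xi j i],
    the variation of [phi] along an edge [kj] is the l1 distance between [xi k]
    and [xi j], and [supp (phi i)] lies in the dual set of [i] exactly because
    every [supp (xi j)] lies in [S j].

    Conditions 2 and 3 are equivalent for every scale, not only for a dual one.
    To flatten a partition of unity, each [phi i] is cut horizontally at the
    values that it takes (a layer-cake decomposition).  Between two consecutive
    levels the layer is either empty or full over each vertex, so it is constant
    on its support, which is contained in [supp (phi i)].  The layers add up to
    [phi i], and each is a nondecreasing function of [phi i], so along an edge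
    their differences all have the same sign and the layers have in total the
    same variation as [phi i] ([sum_layer], [variation_layer]).

    Conversely, a subordinated flat partition of unity is regrouped by choosing
    for each member a set of the scale that contains its support and adding up
    the members assigned to the same set; by the triangle inequality this cannot
    increase the variation. *)

Section Slice.
Variable R : realType.
Implicit Types a b x y : R.

(** For [a <= b], this is the length of the part of the interval from [a] to
    [b] that lies below [x]; written as a difference so that slices
    telescope. *)
Definition slice a b x : R := Num.min b x - Num.min a x.

Lemma slice_homo a b x y : a <= b -> x <= y -> slice a b x <= slice a b y.
Proof.
by rewrite /slice => ab xy; case: (leP b x); case: (leP a x);
  case: (leP b y); case: (leP a y); lra.
Qed.

Lemma slice_ge0 a b x : a <= b -> 0 <= slice a b x.
Proof. by move=> ab; rewrite subr_ge0 le_min !ge_min ab lexx orbT. Qed.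

Lemma slice_below a b x : a <= b -> x <= a -> slice a b x = 0.
Proof. by move=> ab xa; rewrite /slice !min_r ?subrr// (le_trans xa). Qed.

Lemma slice_above a b x : a <= b -> b <= x -> slice a b x = b - a.
Proof. by move=> ab bx; rewrite /slice !min_l// (le_trans ab). Qed.

Lemma sum_slice (t : nat -> R) n x :
  \sum_(l < n) slice (t l) (t l.+1) x = slice (t 0%N) (t n) x.
Proof.
rewrite -(big_mkord predT (fun l => slice (t l) (t l.+1) x)).
by rewrite (telescope_sumr (fun l => Num.min (t l) x)).
Qed.

(** A slice is monotone, so the increments have a common sign and the sum of
    their absolute values telescopes as well. *)
Lemma variation_slice (t : nat -> R) n x y :
  (forall l, (l < n)%N -> t l <= t l.+1) ->
  \sum_(l < n) `|slice (t l) (t l.+1) x - slice (t l) (t l.+1) y|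
    = `|slice (t 0%N) (t n) x - slice (t 0%N) (t n) y|.
Proof.
move=> tS; wlog yx : x y / y <= x => [hwlog|].
  have [/hwlog//|/ltW/hwlog xy] := leP y x.
  by rewrite distrC -xy; apply: eq_bigr => l _; rewrite distrC.
rewrite -!sum_slice -sumrB ger0_norm; last first.
  by apply: sumr_ge0 => l _; rewrite subr_ge0 slice_homo ?tS.
by apply: eq_bigr => l _; rewrite ger0_norm// subr_ge0 slice_homo ?tS.
Qed.

End Slice.

Section Layers.
Variables (R : realType) (V : finType) (f : V -> R).
Hypothesis f_ge0 : forall j, 0 <= f j.

(** Values are kept with multiplicity, so that there are always [#|V|] layers;
    a repeated value only produces a layer that vanishes identically. *)
Definition levels : seq R := 0 :: sort <=%R (codom f).

Definition layer (l : 'I_#|V|) (j : V) : R :=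
  slice (nth 0 levels l) (nth 0 levels l.+1) (f j).

Lemma size_levels : size levels = #|V|.+1.
Proof. by rewrite /= size_sort size_codom. Qed.

Lemma levels_sorted : sorted <=%R levels.
Proof.
rewrite /= path_min_sorted ?sort_le_sorted//.
by apply/allP => x; rewrite mem_sort => /codomP[j ->].
Qed.

Lemma levels_homo m n :
  (m <= n)%N -> (n <= #|V|)%N -> nth 0 levels m <= nth 0 levels n.
Proof.
move=> mn nV; have nS : (n < size levels)%N by rewrite size_levels.
by apply: (sorted_leq_nth le_trans lexx 0 levels_sorted); rewrite ?inE//
  (leq_ltn_trans mn).
Qed.

Lemma level_of j : exists2 m, (m <= #|V|)%N & f j = nth 0 levels m.
Proof.
have fj : f j \in levels by rewrite in_cons mem_sort codom_f orbT.
exists (index (f j) levels); last by rewrite nth_index.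
by rewrite -ltnS -size_levels index_mem.
Qed.

Lemma slice_levels j : slice (nth 0 levels 0) (nth 0 levels #|V|) (f j) = f j.
Proof.
have [m mV fj] := level_of j.
rewrite /slice [nth 0 levels 0]/= (min_l (f_ge0 j)) subr0 min_r//.
by rewrite fj levels_homo.
Qed.

Lemma layer_ge0 l j : 0 <= layer l j.
Proof. by rewrite slice_ge0 ?levels_homo. Qed.

(** No value of [f] lies strictly between two consecutive levels. *)
Lemma layer_flat l j :
  0 < layer l j -> layer l j = nth 0 levels l.+1 - nth 0 levels l.
Proof.
have [m mV fj] := level_of j; have lV := ltn_ord l.
have ab : nth 0 levels l <= nth 0 levels l.+1 by rewrite levels_homo.
rewrite /layer; have [ml|lm] := leqP m l.
  by rewrite slice_below ?ltxx// fj levels_homo// ltnW.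
by rewrite slice_above// fj levels_homo.
Qed.

Lemma supp_layer l : supp (layer l) \subset supp f.
Proof.
apply/subsetP => j; rewrite !inE [0 < f j]lt_def f_ge0 andbT; apply: contraTN => /eqP fj.
have lV := ltnW (ltn_ord l); have level_ge0 : 0 <= nth 0 levels l.
  exact: (levels_homo (leq0n l) lV).
by rewrite /layer fj slice_below ?ltxx ?levels_homo.
Qed.

Lemma sum_layer j : \sum_l layer l j = f j.
Proof. by rewrite (sum_slice (nth 0 levels)) slice_levels. Qed.

Lemma variation_layer k j : \sum_l `|layer l k - layer l j| = `|f k - f j|.
Proof.
rewrite (variation_slice (t := nth 0 levels)) ?slice_levels// => l lV.
exact: levels_homo.
Qed.

End Layers.

Section Equivalences.
Variables (R : realType) (V : finType) (E : rel V) (eps : R).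

Lemma probability_measures_transpose (S : scale V) (xi : V -> V -> R) :
  probability_measures E eps S xi <->
  partition_of_unity E eps (dual_scale S) (fun i j => xi j i).
Proof.
have l1E i : (forall j, 0 <= xi i j) -> l1norm (xi i) = \sum_j xi i j.
  by move=> xi0; apply: eq_bigr => j _; rewrite ger0_norm.
split=> -[h0 h1 h2 h3]; split=> //.
- by move=> j; rewrite -l1E.
- move=> i; apply/subsetP => j; rewrite !inE => xij.
  by rewrite (subsetP (h2 j))// inE.
- by move=> i; rewrite l1E.
- move=> i; apply/subsetP => j xij.
  by have /subsetP/(_ i) := h3 j; rewrite !inE in xij * => /(_ xij).
Qed.

Lemma partition_of_unity_flatten (U : scale V) (phi : V -> V -> R) :
  partition_of_unity E eps U phi ->
  flat_partition_of_unity E eps U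
    (fun a : V * 'I_#|V| => layer (phi a.1) a.2).
Proof.
case=> phi0 phi1 phiE phiU; split.
- by move=> [i l] j; apply: layer_ge0.
- by move=> [i l] j k; rewrite !inE /= => /layer_flat-> // /layer_flat->.
- move=> j; rewrite -(phi1 j) -(pair_bigA _ (fun i l => layer (phi i) l j)) /=.
  by apply: eq_bigr => i _; rewrite sum_layer.
- move=> k j /phiE; apply: le_trans.
  rewrite -(pair_bigA _
    (fun i l => `|layer (phi i) l k - layer (phi i) l j|)) /=.
  by apply: ler_sum => i _; rewrite variation_layer.
- by move=> [i l]; exists i; apply: subset_trans (phiU i); apply: supp_layer.
Qed.

Lemma flat_partition_of_unity_regroup (U : scale V) (A : finType)
    (psi : A -> V -> R) :
  flat_partition_of_unity E eps U psi ->
  exists phi : V -> V -> R, partition_of_unity E eps U phi.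
Proof.
case=> psi0 _ psi1 psiE /fin_all_exists[c psiU].
exists (fun i j => \sum_(a | c a == i) psi a j); split.
- by move=> i j; apply: sumr_ge0.
- by move=> j; rewrite -(psi1 j) [RHS](partition_big c predT).
- move=> k j /psiE; apply: le_trans.
  rewrite [leRHS](partition_big c predT)//=; apply: ler_sum => i _.
  by rewrite -sumrB ler_norm_sum.
- move=> i; apply/subsetP => j; rewrite inE => sum_gt0.
  (* a positive sum of nonnegative terms has a positive term *)
  have [a /eqP <- aj] : exists2 a, c a == i & 0 < psi a j.
    apply/exists_inP; apply: contraTT sum_gt0 => /exists_inPn psiN.
    by rewrite -leNgt; apply: sumr_le0 => a /psiN; rewrite -leNgt.
  by rewrite (subsetP (psiU a))// inE.
Qed.

End Equivalences.

Theorem theorem4p5 (R : realType) (V : finType) (E : rel V)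
    (E_irr : irreflexive E) (eps : R) (eps_gt0 : 0 < eps) (S : scale V) :
  ((exists xi : V -> V -> R, probability_measures E eps S xi) <->
   (exists phi : V -> V -> R, partition_of_unity E eps (dual_scale S) phi)) /\
  ((exists phi : V -> V -> R, partition_of_unity E eps (dual_scale S) phi) <->
   (exists (A : finType) (psi : A -> V -> R),
      flat_partition_of_unity E eps (dual_scale S) psi)).
Proof.
split; split.
- by move=> [xi /probability_measures_transpose]; exists (fun i j => xi j i).
- move=> [phi phiP]; exists (fun i j => phi j i).
  exact/probability_measures_transpose.
- by move=> [phi /partition_of_unity_flatten psiP]; do 2!eexists; exact: psiP.
- by move=> [A [psi /flat_partition_of_unity_regroup]].
Qed.
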